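(* Let $X$ and $Y$ be completely regular Hausdorff spaces, $\mu\in\mathcal{P}_\sigma(X)$, $\nu\in\mathcal{P}_\sigma(Y)$ Baire probability measures, and $c\in lsc_{bi}(X\times Y)$ with $v_{\min}(\mathbf{OP})<+\infty$. Then the following are equivalent: (i) $(\mathbf{DP})$ has a solution; (ii) there exist $\phi^*\in C_b(X)$, $\psi^*\in C_b(Y)$, $\gamma^*\in\Gamma(\mu,\nu)$ with $\phi^*\oplus\psi^*\le c$ and $\int_{X\times Y}c\,d\gamma^*=\int_X\phi^*\,d\mu+\int_Y\psi^*\,d\nu$; (iii) $(\mathbf{DP})$ and $(\mathbf{OP})$ both have solutions and $v_{\max}(\mathbf{DP})=v_{\min}(\mathbf{OP})$. Moreover, if (ii) holds then $(\phi^*,\psi^* )$ is a solution of $(\mathbf{DP})$ and $\gamma^*$ is a solution of $(\mathbf{OP})$.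
   Context: $C_b(Z)$: real-valued bounded continuous functions on $Z$. $\mathcal{M}^1(Z)$: finitely additive $\gamma:\mathcal{U}(Z)\to[0,\infty)$ on the algebra $\mathcal{U}(Z)$ generated by zero-sets, with $\gamma(Z)=1$, regular (for every $A\in\mathcal{U}(Z)$, $\varepsilon>0$ there is a zero-set $F\subseteq A$ with $\gamma(A\setminus F)<\varepsilon$). $lsc_{bi}(Z)$: proper bounded-below lower semicontinuous $g:Z\to\mathbb{R}\cup\{+\infty\}$, with $\int g\,d\gamma:=\sup\{\int f d\gamma: f\in C_b(Z), f\le g\}$. $\mathcal{P}_\sigma(X)$: Baire probability measures. $(\phi\oplus\psi)(x,y):=\phi(x)+\psi(y)$. $\Gamma(\mu,\nu):=\{\gamma\in\mathcal{M}^1(X\times Y):\int\phi\oplus\psi\,d\gamma=\int\phi\,d\mu+\int\psi\,d\nu\ \forall\phi\in C_b(X),\psi\in C_b(Y)\}$. $(\mathbf{OP})$: $v_{\min}(\mathbf{OP}):=\inf\{\int_{X\times Y}c\,d\gamma:\gamma\in\Gamma(\mu,\nu)\}$; a solution is a minimizer in $\Gamma(\mu,\nu)$. $(\mathbf{DP})$: $v_{\max}(\mathbf{DP}):=\sup\{\int_X\phi\,d\mu+\int_Y\psi\,d\nu:\phi\in C_b(X),\psi\in C_b(Y),\phi\oplus\psi\le c\}$; a solution is an admissible pair attaining the supremum. *)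

(* Defs.v *)
From HB Require Import structures.
From mathcomp Require Import all_boot all_order all_algebra.
From mathcomp Require Import all_classical all_reals all_analysis.
Set Implicit Arguments. Unset Strict Implicit. Unset Printing Implicit Defensive.
Import Order.TTheory GRing.Theory Num.Theory.
Import numFieldNormedType.Exports.
Local Open Scope classical_set_scope.
Local Open Scope ring_scope.

Section OTdefs.
Context {R : realType}.

Definition Cb {T : topologicalType} (f : T -> R) : Prop :=
  continuous f /\ exists M : R, forall x, `|f x| <= M.

Definition zero_set {T : topologicalType} (Z : set T) : Prop :=
  exists f : T -> R, continuous f /\ Z = f @^-1` [set 0].

Definition set_algebra {T : Type} (C : set (set T)) : Prop :=
  [/\ C set0, (forall A, C A -> C (~` A)) & (forall A B, C A -> C B -> C (A `|` B))].

Definition U_alg {T : topologicalType} : set (set T) :=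
  smallest set_algebra (@zero_set T).

(* M^1(Z): regular finitely additive probabilities on U(Z).
   (values of gamma outside U(Z) are irrelevant) *)
Definition fa_prob {T : topologicalType} (gamma : set T -> R) : Prop :=
  [/\ (forall A, U_alg A -> 0 <= gamma A),
      (forall A B, U_alg A -> U_alg B -> A `&` B = set0 ->
          gamma (A `|` B) = gamma A + gamma B),
      gamma setT = 1 &
      (forall A, U_alg A -> forall e : R, 0 < e ->
          exists F, [/\ zero_set F, F `<=` A & gamma (A `\` F) < e])].

(* integral of a function w.r.t. a finitely additive gamma: supremum of the
   integrals of U(Z)-simple functions lying below f (for f in C_b this is
   the usual integral w.r.t. a finitely additive measure) *)
Definition fa_integral {T : topologicalType} (gamma : set T -> R) (f : T -> R) : R :=
  sup [set r : R | exists (n : nat) (a : 'I_n -> R) (A : 'I_n -> set T),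
        [/\ (forall i, U_alg (A i)),
            (forall x, \sum_(i < n) a i * \1_(A i) x <= f x) &
            r = \sum_(i < n) a i * gamma (A i)]].

Definition lsc_bi {T : topologicalType} (g : T -> \bar R) : Prop :=
  [/\ lower_semicontinuous g,
      (exists m : R, forall x, (m%:E <= g x)%E) &
      (exists x, (g x < +oo)%E)].

Definition lsc_integral {T : topologicalType} (gamma : set T -> R)
    (g : T -> \bar R) : \bar R :=
  ereal_sup [set (fa_integral gamma f)%:E | f in [set f | Cb f /\ forall x, ((f x)%:E <= g x)%E]].

Definition BaireSpace (X : ptopologicalType) := g_sigma_algebraType (@zero_set X).

Section transport.
Context {X Y : ptopologicalType}
  (mu : probability (BaireSpace X) R) (nu : probability (BaireSpace Y) R).

Definition intmu (phi : X -> R) : \bar R := (\int[mu]_(x in setT) (phi x)%:E)%E.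
Definition intnu (psi : Y -> R) : \bar R := (\int[nu]_(y in setT) (psi y)%:E)%E.

Definition Gamma (gamma : set (X * Y) -> R) : Prop :=
  fa_prob gamma /\
  forall (phi : X -> R) (psi : Y -> R), Cb phi -> Cb psi ->
    (fa_integral gamma (fun z => phi z.1 + psi z.2))%:E = (intmu phi + intnu psi)%E.

Variable c : X * Y -> \bar R.

Definition v_min_OP : \bar R := ereal_inf [set lsc_integral gamma c | gamma in Gamma].

Definition OP_solution (gamma : set (X * Y) -> R) : Prop :=
  Gamma gamma /\ lsc_integral gamma c = v_min_OP.

Definition DP_admissible (phi : X -> R) (psi : Y -> R) : Prop :=
  [/\ Cb phi, Cb psi & forall x y, ((phi x + psi y)%:E <= c (x, y))%E].

Definition v_max_DP : \bar R :=
  ereal_sup [set (intmu pp.1 + intnu pp.2)%E | pp in [set pp | DP_admissible pp.1 pp.2]].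

Definition DP_solution (phi : X -> R) (psi : Y -> R) : Prop :=
  DP_admissible phi psi /\ (intmu phi + intnu psi)%E = v_max_DP.

End transport.
End OTdefs.

(* Main.v *)
Require Import Defs.
From HB Require Import structures.
From mathcomp Require Import all_boot all_order all_algebra.
From mathcomp Require Import all_classical all_reals all_analysis.
From mathcomp Require Import ring lra.
Import Order.TTheory GRing.Theory Num.Theory.
Import numFieldNormedType.Exports.
Local Open Scope classical_set_scope.
Local Open Scope ring_scope.

(** Weak duality is immediate, so everything rests on finding gamma in
    Gamma(mu, nu) with int c dgamma <= v := v_max(DP). Impose on a linear
    functional L on bounded functions the constraints L h <= I(phi, psi) + t v
    whenever h <= phi (+) psi + t f with t >= 0, f in C_b and f <= c. They form
    a convex cone, and it is consistent precisely by the definition of v, so a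
    Hahn-Banach argument gives L with L(phi (+) psi) = I(phi, psi) and L f <= v
    for all f in C_b below c.

    Such an L comes from a regular gamma (Alexandroff). Put
    lambda F := inf {L g | g in C_b, 1_F <= g} for zero sets F. Continuous
    separation of disjoint zero sets shows that f >= sum_i s_i 1_{F_i} implies
    L f >= sum_i s_i lambda F_i; by Hahn-Banach again, L restricted to C_b
    extends to bounded functions with L 1_F = lambda F for all zero sets F
    simultaneously. Then A |-> L 1_A is finitely additive on all sets,
    integrates C_b as L does, and is regular on the algebra of zero sets. *)

(** * Means on bounded functions and their construction from cones of constraints *)

Definition bdd_fun {T : Type} {R : realType} (f : T -> R) : Prop :=
  exists M : R, forall x, `|f x| <= M.

Section Means.
Context {T : Type} {R : realType}.
Implicit Types f g h : T -> R.

Lemma bdd_cst (a : R) : bdd_fun (fun _ : T => a).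
Proof. by exists `|a|. Qed.

Lemma bddD f g : bdd_fun f -> bdd_fun g ->
  bdd_fun (fun x => f x + g x).
Proof.
move=> [M fM] [N gN]; exists (M + N) => x.
by rewrite (le_trans (ler_normD _ _))// lerD.
Qed.

Lemma bddZ (t : R) f : bdd_fun f -> bdd_fun (fun x => t * f x).
Proof.
by move=> [M fM]; exists (`|t| * M) => x; rewrite normrM ler_wpM2l.
Qed.

Lemma bddN f : bdd_fun f -> bdd_fun (fun x => - f x).
Proof. by move=> [M fM]; exists M => x; rewrite normrN. Qed.

Lemma bddB f g : bdd_fun f -> bdd_fun g ->
  bdd_fun (fun x => f x - g x).
Proof. by move=> bf bg; apply: bddD => //; apply: bddN. Qed.

Lemma bdd_indic (A : set T) : bdd_fun (\1_A : T -> R).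
Proof. by exists 1 => x; rewrite indicE; case: (_ \in _); rewrite ?normr1 ?normr0. Qed.

(* Only the values on bounded functions matter. *)
Definition mean (L : (T -> R) -> R) : Prop :=
  [/\ forall f g, bdd_fun f -> bdd_fun g ->
        L (fun x => f x + g x) = L f + L g,
      forall t f, bdd_fun f -> L (fun x => t * f x) = t * L f,
      forall f g, bdd_fun f -> bdd_fun g ->
        (forall x, f x <= g x) -> L f <= L g &
      L (fun=> 1) = 1].

Section MeanTheory.
Context {L : (T -> R) -> R} (mL : mean L).

Lemma meanD f g : bdd_fun f -> bdd_fun g ->
  L (fun x => f x + g x) = L f + L g.
Proof. by case: mL => + _ _ _; apply. Qed.

Lemma meanZ t f : bdd_fun f -> L (fun x => t * f x) = t * L f.
Proof. by case: mL => _ + _ _; apply. Qed.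

Lemma le_mean f g : bdd_fun f -> bdd_fun g ->
  (forall x, f x <= g x) -> L f <= L g.
Proof. by case: mL => _ _ + _; apply. Qed.

Lemma mean_cst t : L (fun=> t) = t.
Proof.
case: mL => _ _ _ L1; rewrite -[RHS]mulr1 -L1 -meanZ; last exact: bdd_cst.
by congr L; apply/funext => x; rewrite mulr1.
Qed.

Lemma meanN f : bdd_fun f -> L (fun x => - f x) = - L f.
Proof.
move=> bf; rewrite -mulN1r -meanZ//.
by congr L; apply/funext => x; rewrite mulN1r.
Qed.

Lemma meanB f g : bdd_fun f -> bdd_fun g ->
  L (fun x => f x - g x) = L f - L g.
Proof. by move=> bf bg; rewrite meanD ?meanN//; apply: bddN. Qed.

Lemma mean_ge0 f : bdd_fun f -> (forall x, 0 <= f x) -> 0 <= L f.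
Proof.
by move=> bf f0; rewrite -(mean_cst 0); apply: le_mean => //; exact: bdd_cst.
Qed.

Lemma bdd_simple n (a : 'I_n -> R) (A : 'I_n -> set T) :
  bdd_fun (fun x => \sum_(i < n) a i * \1_(A i) x).
Proof.
elim: n a A => [|n IH] a A.
  by exists 0 => x; rewrite big_ord0 normr0.
under [X in bdd_fun X]funext do rewrite big_ord_recl.
by apply: bddD; [apply/bddZ/bdd_indic|exact: IH].
Qed.

Lemma mean_simple n (a : 'I_n -> R) (A : 'I_n -> set T) :
  L (fun x => \sum_(i < n) a i * \1_(A i) x) = \sum_(i < n) a i * L \1_(A i).
Proof.
elim: n a A => [|n IH] a A.
  rewrite big_ord0 -[RHS](mean_cst 0); congr L.
  by apply/funext => x; rewrite big_ord0.
rewrite big_ord_recl -IH -meanZ; last exact: bdd_indic.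
rewrite -meanD; first last.
- exact: bdd_simple.
- exact/bddZ/bdd_indic.
by congr L; apply/funext => x; rewrite big_ord_recl.
Qed.

End MeanTheory.

(** The last clause is consistency: the constraints never combine to [L 0 <= r] with [r < 0]. *)
Definition cone (A : set ((T -> R) * R)) : Prop :=
  [/\ forall f r g s, A (f, r) -> A (g, s) -> A (fun x => f x + g x, r + s),
      forall t f r, 0 <= t -> A (f, r) -> A (fun x => t * f x, t * r) &
      forall r, A (fun=> 0, r) -> 0 <= r].

Lemma maximal_cone (P : set ((T -> R) * R)) : cone P -> P !=set0 ->
  exists M, [/\ cone M, P `<=` M & forall N, cone N -> M `<=` N -> N `<=` M].
Proof.
move=> coneP [p0 Pp0].
pose C A := A = set0 \/ (cone A /\ P `<=` A).
have [F FC Ftot|M [CM Mmax]] := @Zorn_bigcup _ C.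
  have [[X0 [FX0 [x0 X0x0]]]|nF] := pselect (exists X, F X /\ X !=set0); last first.
    left; apply/seteqP; split=> // x [X FX Xx]; apply: nF.
    by exists X; split=> //; exists x.
  have Fcone X x : F X -> X x -> cone X /\ P `<=` X.
    by move=> FX Xx; case: (FC _ FX) => // X0'; move: Xx; rewrite X0'.
  right; split; last first.
    by move=> p Pp; exists X0 => //; apply: (Fcone _ _ FX0 X0x0).2.
  split.
  - move=> f r g s [X FX Xf] [Y FY Yg].
    have [XY|YX] := Ftot _ _ FX FY.
    + by exists Y => //; case: (Fcone _ _ FY Yg) => -[+ _ _] _; apply=> //; exact: XY.
    + by exists X => //; case: (Fcone _ _ FX Xf) => -[+ _ _] _; apply=> //; exact: YX.
  - move=> t f r t0 [X FX Xf]; exists X => //.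
    by case: (Fcone _ _ FX Xf) => -[_ + _] _; apply.
  - move=> r [X FX Xr].
    by case: (Fcone _ _ FX Xr) => -[_ _ +] _; apply.
have [M0|[coneM PM]] := CM.
  exfalso; apply: (Mmax P); last by right; split.
  by rewrite M0; split=> // /(_ _ Pp0).
exists M; split=> // N coneN MN; apply: contrapT => nNM.
by apply: (Mmax N) => //; right; split=> //; exact: subset_trans MN.
Qed.

(* A pair (h, r) stands for the constraint "L h <= r". In a maximal consistent
   cone of constraints every bounded h comes with equality: the constraint
   L h >= inf {r | (h, r)} can always be added. *)
Lemma cone_mean (P : set ((T -> R) * R)) : cone P ->
  (forall f g r, (forall x, f x <= g x) -> P (g, r) -> P (f, r)) ->
  P (fun=> 1, 1) -> P (fun=> -1, -1) ->
  exists L, mean L /\ forall f r, bdd_fun f -> P (f, r) -> L f <= r.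
Proof.
move=> coneP Pmono P1 PN1.
have [M [[MD MZ Mcons] PM Mmax]] : exists M, [/\ cone M, P `<=` M &
    forall N, cone N -> M `<=` N -> N `<=` M].
  by apply: maximal_cone => //; exists (fun=> 1, 1).
have M00 : M (fun=> 0, 0).
  by have := MZ 0 _ _ (lexx 0) (PM _ P1); rewrite !mul0r.
(* A bounded function lies below a constant, whose constraint is a nonnegative multiple of the one
   on [1] or on [-1], according to its sign. *)
have Mdom f : bdd_fun f -> exists r, M (f, r).
  move=> [b fb]; have [b0|b0] := leP 0 b.
    exists (b * 1); apply: PM; apply: (Pmono _ (fun=> b * 1)).
      by move=> x; rewrite mulr1 (le_trans (ler_norm _)).
    by case: coneP => _ + _; apply.
  exists (- b * -1); apply: PM; apply: (Pmono _ (fun=> - b * -1)).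
    by move=> x; rewrite mulrNN mulr1 (le_trans (ler_norm _)).
  by case: coneP => _ + _; apply=> //; rewrite oppr_ge0 ltW.
have Mle f r s : M (f, r) -> M (fun x => - f x, - s) -> s <= r.
  move=> Mf MNf; rewrite -subr_ge0; apply: Mcons.
  have := MD _ _ _ _ Mf MNf.
  by congr (M (_, _)); apply/funext => x; rewrite subrr.
pose L f := inf [set r | M (f, r)].
have Llb f : bdd_fun f -> has_lbound [set r | M (f, r)].
  move=> /bddN/Mdom[s Ms]; exists (- s) => r /= Mr.
  by apply: Mle Mr _; rewrite opprK.
have L_le f r : bdd_fun f -> M (f, r) -> L f <= r.
  by move=> bf Mr; apply: ge_inf => //; exact: Llb.
have MNL f : bdd_fun f -> M (fun x => - f x, - L f).
  move=> bf.
  (* [N] adjoins the lower bound [(- f, - L f)] to [M]. If [(w, s)] in [M] and [t > 0] combine to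
     the zero function, then [w = t f], so [(f, s / t)] is in [M] and [L f <= s / t]: [N] is
     consistent, and maximality gives [N] inside [M]. *)
  pose N := [set z : (T -> R) * R | exists w s t, [/\ M (w, s), 0 <= t &
     z = (fun x => w x - t * f x, s - t * L f)]].
  apply: (Mmax N); last first.
  - exists (fun=> 0), 0, 1; split=> //; congr pair; last by ring.
    by apply/funext => x; ring.
  - move=> [w s] Mws; exists w, s, 0; split=> //; congr pair; last by ring.
    by apply/funext => x; ring.
  split.
  - move=> _ _ _ _ [w [s [t [Mw t0 [-> ->]]]]] [w' [s' [t' [Mw' t0' [-> ->]]]]].
    exists (fun x => w x + w' x), (s + s'), (t + t'); split=> //.
    + exact: MD.
    + exact: addr_ge0.
    + congr pair; last by ring.
      by apply/funext => x; ring.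
  - move=> u _ _ u0 [w [s [t [Mw t0 [-> ->]]]]].
    exists (fun x => u * w x), (u * s), (u * t); split=> //.
    + exact: MZ.
    + exact: mulr_ge0.
    + congr pair; last by ring.
      by apply/funext => x; ring.
  - move=> r [w [s [t [Mw t0 [wE ->]]]]].
    have {}wE : w = (fun x => t * f x).
      by apply/funext => x; apply/eqP; rewrite -subr_eq0 -(congr1 (@^~ x) wE).
    rewrite subr_ge0; move: t0; rewrite le_eqVlt => /predU1P[t0|t0].
      rewrite -t0 mul0r; apply: Mcons.
      move: Mw; rewrite wE -t0.
      by congr (M (_, _)); apply/funext => x; rewrite mul0r.
    rewrite mulrC -ler_pdivlMr// mulrC; apply: L_le => //.
    have ti0 : 0 <= t^-1 by rewrite invr_ge0 ltW.
    have := MZ _ _ _ ti0 Mw; congr (M (_, _)); apply/funext => x.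
    by rewrite wE mulrA mulVf ?mul1r// gt_eqF.
have NNf f : (fun x => - - f x) = f by apply/funext => x; rewrite opprK.
(* [MNL] at [- f] puts [(f, - L (- f))] in [M]; as this bound equals [L f], the infimum defining
   [L f] is attained. *)
have ML f : bdd_fun f -> M (f, L f).
  move=> bf; have /MNL := bddN _ bf; rewrite NNf => Mf.
  suff -> : L f = - L (fun x => - f x) by [].
  apply/le_anti/andP; split; first exact: L_le.
  apply: lb_le_inf; first exact: Mdom.
  move=> r /= Mr; rewrite lerNl; apply: lb_le_inf.
    by apply: Mdom; exact: bddN.
  by move=> s /= Ms; rewrite lerNl; apply: Mle Mr _; rewrite opprK.
have LE f r : bdd_fun f -> M (f, r) -> M (fun x => - f x, - r) -> L f = r.
  move=> bf Mr MNr; apply/le_anti/andP; split; first exact: L_le.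
  exact: (Mle _ _ _ (ML _ bf) MNr).
have LD f g : bdd_fun f -> bdd_fun g ->
    L (fun x => f x + g x) = L f + L g.
  move=> bf bg; apply: LE; first exact: bddD.
    by apply: MD; exact: ML.
  have := MD _ _ _ _ (MNL _ bf) (MNL _ bg); rewrite -opprD.
  by congr (M (_, _)); apply/funext => x; rewrite opprD.
have LN f : bdd_fun f -> L (fun x => - f x) = - L f.
  move=> bf; apply: LE; first exact: bddN.
    exact: MNL.
  by rewrite NNf opprK; exact: ML.
have LZ0 t f : 0 <= t -> bdd_fun f -> L (fun x => t * f x) = t * L f.
  move=> t0 bf; apply: LE; first exact: bddZ.
    by apply: MZ => //; exact: ML.
  have := MZ _ _ _ t0 (MNL _ bf); rewrite mulrN.
  by congr (M (_, _)); apply/funext => x; rewrite mulrN.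
exists L; split; last by move=> f r bf /PM; exact: L_le.
split=> //.
- move=> t f bf; have [t0|/ltW t0] := leP 0 t; first exact: LZ0.
  rewrite -[t]opprK mulNr -LZ0// -?LN ?oppr_ge0//; last exact: bddZ.
  by congr L; apply/funext => x; rewrite mulNr.
- move=> f g bf bg fg.
  rewrite -subr_le0 -LN// -LD//; last exact: bddN.
  apply: L_le; first exact: bddB.
  apply: PM; apply: (Pmono _ (fun=> 0)) => [x|]; first by rewrite subr_le0.
  by have := (let: And3 _ Z _ := coneP in Z) 0 _ _ (lexx 0) P1; rewrite !mul0r.
- by apply: LE; [exact: bdd_cst|exact: PM|exact: PM].
Qed.

End Means.


(** * Bounded continuous functions and the lattice of zero sets *)

Section ContinuousBounded.
Context {T : topologicalType} {R : realType}.
Implicit Types f g : T -> R.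

Lemma Cb_cst (a : R) : Cb (fun _ : T => a).
Proof. by split; [move=> x; exact: cvg_cst|exact: bdd_cst]. Qed.

Lemma CbD f g : Cb f -> Cb g -> Cb (fun x => f x + g x).
Proof.
move=> [cf bf] [cg bg]; split; last exact: bddD.
by move=> x; apply: cvgD; [exact: cf|exact: cg].
Qed.

Lemma CbZ (t : R) f : Cb f -> Cb (fun x => t * f x).
Proof.
move=> [cf bf]; split; last exact: bddZ.
by move=> x; apply: cvgM; [exact: cvg_cst|exact: cf].
Qed.

Lemma CbN f : Cb f -> Cb (fun x => - f x).
Proof.
move=> [cf bf]; split; last exact: bddN.
by move=> x; apply: cvgN; exact: cf.
Qed.

Lemma CbB f g : Cb f -> Cb g -> Cb (fun x => f x - g x).
Proof. by move=> cf cg; apply: CbD => //; exact: CbN. Qed.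

Lemma Cb_max f g : Cb f -> Cb g -> Cb (fun x => Num.max (f x) (g x)).
Proof.
move=> [cf [M fM]] [cg [N gN]]; split.
  by move=> x; apply: (@continuous_max _ _ f g); [exact: cf|exact: cg].
exists (Num.max M N) => x.
have [fg|fg] := leP (f x) (g x); last first.
  by rewrite (le_trans (fM x))// le_max lexx.
by rewrite (le_trans (gN x))// le_max lexx orbT.
Qed.

Lemma zero_set_le f g : continuous f -> continuous g ->
  @zero_set R T [set x | f x <= g x].
Proof.
move=> cf cg; exists (fun x => Num.max (f x - g x) 0); split.
  move=> x; apply: (@continuous_max _ _ (fun x => f x - g x) (cst 0)); last exact: cvg_cst.
  by apply: cvgB; [exact: cf|exact: cg].
apply/seteqP; split => x /=.
  by move=> fg; apply/max_idPr; rewrite subr_le0.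
by move=> /max_idPr; rewrite subr_le0.
Qed.

Lemma zero_set_set0 : @zero_set R T set0.
Proof.
exists (fun=> 1); split; first by move=> x; exact: cvg_cst.
by apply/seteqP; split => x //= /eqP; rewrite oner_eq0.
Qed.

Lemma zero_set_setT : @zero_set R T setT.
Proof.
by exists (fun=> 0); split; [move=> x; exact: cvg_cst|apply/seteqP; split].
Qed.

Lemma zero_setU (A B : set T) :
  @zero_set R T A -> @zero_set R T B -> @zero_set R T (A `|` B).
Proof.
move=> [f [cf ->]] [g [cg ->]]; exists (fun x => f x * g x); split.
  by move=> x; apply: cvgM; [exact: cf|exact: cg].
apply/seteqP; split => x /=.
  by move=> [] ->; rewrite ?mul0r ?mulr0.
by move=> /eqP; rewrite mulf_eq0 => /orP[]/eqP; [left|right].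
Qed.

Lemma zero_setI (A B : set T) :
  @zero_set R T A -> @zero_set R T B -> @zero_set R T (A `&` B).
Proof.
move=> [f [cf ->]] [g [cg ->]]; exists (fun x => `|f x| + `|g x|); split.
  by move=> x; apply: cvgD; apply: cvg_norm; [exact: cf|exact: cg].
apply/seteqP; split => x /=.
  by move=> [-> ->]; rewrite normr0 addr0.
move=> /eqP; rewrite paddr_eq0// !normr_eq0 => /andP[/eqP ? /eqP ?]; by split.
Qed.

(** If [A] and [B] are the zero sets of [a] and [b], then [|b| / (|a| + |b|)] separates them;
    disjointness keeps the denominator positive. *)
Lemma zero_set_separation (A B : set T) :
  @zero_set R T A -> @zero_set R T B -> A `&` B = set0 ->
  exists g, [/\ Cb g, forall x, 0 <= g x <= 1, forall x, A x -> g x = 1 &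
    forall x, B x -> g x = 0].
Proof.
move=> [a [ca ->]] [b [cb ->]] AB0.
have ab0 x : 0 < `|a x| + `|b x|.
  rewrite lt_neqAle addr_ge0// andbT eq_sym paddr_eq0// !normr_eq0.
  apply/negP => /andP[/eqP ax /eqP bx].
  by have : set0 x by rewrite -AB0.
have g01 x : 0 <= `|b x| / (`|a x| + `|b x|) <= 1.
  by rewrite divr_ge0 ?(ltW (ab0 x))//= ler_pdivrMr// mul1r lerDr.
exists (fun x => `|b x| / (`|a x| + `|b x|)); split => //.
- split.
    move=> x; apply: cvgM; first by apply: cvg_norm; exact: cb.
    apply: cvgV; first by rewrite gt_eqF.
    by apply: cvgD; apply: cvg_norm; [exact: ca|exact: cb].
  by exists 1 => x; have /andP[? ?] := g01 x; rewrite ger0_norm.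
- move=> x /= ax; have := ab0 x.
  by rewrite ax normr0 add0r => bx; rewrite divff// gt_eqF.
- by move=> x /= ->; rewrite normr0 mul0r.
Qed.

End ContinuousBounded.

(** * Extending a mean from [C_b] so that it becomes regular on zero sets *)

Section RegularMean.
Context {T : topologicalType} {R : realType}.
Context {L : (T -> R) -> R} (mL : mean L).
Implicit Types (f g h v : T -> R) (F : set T).

(** This is [lambda F], the only value that a regular measure representing [L] on [C_b] can give to
    a zero set [F]. *)
Definition outer_mean F : R :=
  inf [set r | exists g, [/\ Cb g, forall x, \1_F x <= g x & r = L g]].

Lemma outer_mean_le F g : Cb g -> (forall x, \1_F x <= g x) ->
  outer_mean F <= L g.
Proof.
move=> Cg Fg; apply: ge_inf; last by exists g.
exists 0 => _ [h [[_ bh] Fh ->]]; apply: mean_ge0 => // x.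
by rewrite (le_trans _ (Fh x))// indicE.
Qed.

(** A relation rather than a function of [v]: the number [sum_i s_i lambda F_i] is attached to a
    presentation [v = sum_i s_i 1_{F_i}] and could a priori change with it. The inductive form lets
    proofs peel off one zero set at a time. *)
Inductive zsum : (T -> R) -> R -> Prop :=
| zsum0 : zsum (fun=> 0) 0
| zsumS v r F s : zsum v r -> zero_set (R := R) F -> 0 <= s ->
    zsum (fun x => v x + s * \1_F x) (r + s * outer_mean F).

Lemma zsumD v r w s : zsum v r -> zsum w s ->
  zsum (fun x => v x + w x) (r + s).
Proof.
move=> zv; elim => [|w' s' F t _ IH zF t0].
  by rewrite addr0; under [X in zsum X]funext do rewrite addr0.
rewrite addrA; under [X in zsum X]funext do rewrite addrA.
exact: zsumS.
Qed.

Lemma zsumZ t v r : 0 <= t -> zsum v r -> zsum (fun x => t * v x) (t * r).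
Proof.
move=> t0; elim => [|w s F u _ IH zF u0].
  by rewrite !mulr0; exact: zsum0.
rewrite mulrDr mulrA; under [X in zsum X]funext do rewrite mulrDr mulrA.
by apply: zsumS => //; exact: mulr_ge0.
Qed.

(** The condition [f <= w + t 1_F] holds where [f <= w], or on [F] where [f - t <= w]. The shift by
    [t] is why the induction runs over all [f]. *)
Lemma zero_set_zsum v r f : zsum v r -> continuous f ->
  @zero_set R T [set x | f x <= v x].
Proof.
move=> zv; elim: zv f => [|w s F t _ IH zF t0] f cf.
  by apply: zero_set_le => // x; exact: cvg_cst.
have -> : [set x | f x <= w x + t * \1_F x] =
    [set x | f x <= w x] `|` ([set x | f x - t <= w x] `&` F).
  apply/seteqP; split => x /=; rewrite indicE.
    have [Fx|Fx] := pselect (F x).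
      by rewrite mem_set// mulr1 => ?; right; split => //; rewrite lerBlDr.
    by rewrite memNset// mulr0 addr0; left.
  move=> [fw|[fw Fx]]; first by rewrite (le_trans fw)// lerDl mulr_ge0.
  by rewrite mem_set// mulr1 -lerBlDr.
apply: zero_setU; first exact: IH.
apply: zero_setI => //; apply: IH => x.
by apply: cvgB; [exact: cf|exact: cvg_cst].
Qed.

(* Splitting step: if f >= v + s 1_F then F and {f - s + e <= v} are disjoint
   zero sets, so a continuous function separating them can be subtracted
   from f, leaving at least v - e. *)
Lemma zsum_le v r f : zsum v r -> Cb f -> (forall x, v x <= f x) -> r <= L f.
Proof.
move=> zv; elim: zv f => [|w s F t zw IH zF t0] f Cf vf.
  by apply: mean_ge0 => //; case: Cf.
apply/ler_addgt0Pr => e e0.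
pose C := [set x | f x - (t - e) <= w x].
have [||g [Cg g01 gF gC]] := @zero_set_separation T R F C zF.
- apply: zero_set_zsum zw _ => x; apply: cvgB; last exact: cvg_cst.
  by case: Cf => + _; apply.
- apply/seteqP; split => // x [Fx]; rewrite /C/= => Cx.
  by have := vf x; rewrite indicE mem_set// mulr1 => ?; exfalso; lra.
have CF : Cb (fun x => f x - t * g x + e).
  by apply: CbD; [apply: CbB => //; exact: CbZ|exact: Cb_cst].
have Lg : outer_mean F <= L g.
  apply: outer_mean_le => // x; rewrite indicE.
  have [Fx|Fx] := pselect (F x); first by rewrite mem_set// gF.
  by rewrite memNset//; case/andP: (g01 x).
have : s <= L (fun x => f x - t * g x + e).
  apply: IH => // x.
  have [Cx|/negP] := boolP (f x - (t - e) <= w x).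
    rewrite gC// mulr0 subr0 (le_trans (y := f x)) ?lerDl ?(ltW e0)//.
    by rewrite (le_trans _ (vf x))// lerDl mulr_ge0// indicE.
  move=> /negP; rewrite -ltNge => Cx.
  have /andP[_ g1] := g01 x.
  have : t * g x <= t by rewrite ler_piMr.
  lra.
case: Cf Cg => [_ bf] [_ bg].
rewrite (meanD mL)//; [|by apply: bddB => //; exact: bddZ|exact: bdd_cst].
rewrite (meanB mL)//; last exact: bddZ.
rewrite (meanZ mL)// (mean_cst mL).
have : t * outer_mean F <= t * L g by exact: ler_wpM2l.
lra.
Qed.

Lemma regular_mean_extension : exists K : (T -> R) -> R, [/\ mean K,
  forall f, Cb f -> K f = L f &
  forall F, zero_set (R := R) F -> forall e, 0 < e ->
    exists g, [/\ Cb g, forall x, \1_F x <= g x & K g < K \1_F + e]].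
Proof.
(* The cone generated by [K f <= L f] for [f] in [C_b] and [K 1_F >= lambda F] for zero sets [F]:
   from [h <= f - v] one infers [K h <= L f - a]. Its consistency is exactly [zsum_le]. *)
pose P := [set z : (T -> R) * R | exists f v a, [/\ Cb f, zsum v a,
  forall x, z.1 x + v x <= f x & L f - a <= z.2]].
have [|||| K [mK KP]] := @cone_mean T R P.
- split.
  + move=> h r k s [f [v [a [Cf zv /= hf fr]]]] [g [w [b [Cg zw /= kg gs]]]].
    exists (fun x => f x + g x), (fun x => v x + w x), (a + b).
    split; [exact: CbD|exact: zsumD| |] => /= [x|].
      by have := hf x; have := kg x; lra.
    by case: Cf Cg => _ bf [_ bg]; rewrite (meanD mL)//; lra.
  + move=> t h r t0 [f [v [a [Cf zv /= hf fr]]]].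
    exists (fun x => t * f x), (fun x => t * v x), (t * a).
    split; [exact: CbZ|exact: zsumZ| |] => /= [x|].
      by rewrite -mulrDr ler_wpM2l.
    by case: Cf => _ bf; rewrite (meanZ mL)// -mulrBr ler_wpM2l.
  + move=> r [f [v [a [Cf zv /= hf]]]]; apply: le_trans.
    rewrite subr_ge0; apply: zsum_le zv Cf _ => x.
    by rewrite -[leLHS]add0r.
- move=> h k r hk [f [v [a [Cf zv /= hf fr]]]]; exists f, v, a; split=> //= x.
  by rewrite (le_trans _ (hf x))// lerD2r.
- exists (fun=> 1), (fun=> 0), 0; split; [exact: Cb_cst|exact: zsum0| |] => /= [x|].
    by rewrite addr0.
  by rewrite subr0 (mean_cst mL).
- exists (fun=> -1), (fun=> 0), 0; split; [exact: Cb_cst|exact: zsum0| |] => /= [x|].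
    by rewrite addr0.
  by rewrite subr0 (mean_cst mL).
have KL f : Cb f -> K f <= L f.
  move=> Cf; apply: KP; first by case: Cf.
  exists f, (fun=> 0), 0; split => //=; first exact: zsum0.
    by move=> x; rewrite addr0.
  by rewrite subr0.
have KE f : Cb f -> K f = L f.
  move=> Cf; apply/le_anti; rewrite KL//=.
  have := KL _ (CbN _ Cf).
  by case: Cf => _ bf; rewrite (meanN mK)// (meanN mL)// lerN2.
exists K; split => // F zF e e0.
have F1 : outer_mean F <= K \1_F.
  rewrite -lerN2 -(meanN mK); last exact: bdd_indic.
  apply: KP; first by apply: bddN; exact: bdd_indic.
  exists (fun=> 0), (fun x => 0 + 1 * \1_F x), (0 + 1 * outer_mean F).
  split => /=; [exact: Cb_cst|by apply: zsumS => //; exact: zsum0| |].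
    by move=> x; rewrite add0r mul1r addNr.
  by rewrite (mean_cst mL) add0r mul1r add0r.
(* A near-minimizer [g] for [lambda F] works, because [K g = L g < lambda F + e <= K 1_F + e]. *)
have [|_ [g [Cg Fg ->]] gF] := @inf_adherent R
    [set r | exists g, [/\ Cb g, forall x, \1_F x <= g x & r = L g]] e e0.
  split.
    exists (L (fun=> 1)), (fun=> 1); split => //; first exact: Cb_cst.
  exists 0 => _ [h [[_ bh] Fh ->]]; apply: mean_ge0 => // x.
  by rewrite (le_trans _ (Fh x))// indicE.
by exists g; split => //; rewrite KE// (lt_le_trans gF)// lerD2r.
Qed.

End RegularMean.


(** * Layer sums and the Alexandroff representation of means by regular measures *)

Section Layers.
Context {R : realType}.

(* The sum is min (n, floor u). *)
Lemma layer_sum (u : R) n : 0 <= u ->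
  let S : R := \sum_(i < n) ((i.+1)%:R <= u)%R%:R in
  [/\ S <= n%:R, S <= u & u <= S + 1 \/ S = n%:R].
Proof.
move=> u0; elim: n => [|n [Sn Su IH]] /=.
  by rewrite big_ord0; split=> //; right.
rewrite big_ord_recr/=; move: Sn Su IH.
set S := (\sum_(i < n) _) => Sn Su IH.
rewrite -natr1.
have [nu|nu] := leP (n%:R + 1) u; last first.
  by rewrite addr0; split=> //; [lra|left; case: IH => ?; lra].
by rewrite /=; split; [lra|case: IH => ?; lra|right; case: IH => ?; lra].
Qed.

End Layers.

Section Alexandroff.
Context {T : topologicalType} {R : realType}.
Implicit Types (f g : T -> R) (A B F : set T) (K : (T -> R) -> R).

Lemma U_alg_zero F : zero_set (R := R) F -> U_alg (R := R) F.
Proof. by move=> zF C [_]; apply. Qed.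

Lemma mean_indicU K A B C : mean K -> C `<=` A `|` B ->
  K \1_C <= K \1_A + K \1_B.
Proof.
move=> mK CAB; rewrite -(meanD mK); [|exact: bdd_indic..].
apply: (le_mean mK); [exact: bdd_indic|by apply: bddD; exact: bdd_indic|].
move=> x; rewrite !indicE -natrD ler_nat.
have [Cx|] := boolP (x \in C); last by [].
have [] : A x \/ B x by apply: CAB; move: Cx; rewrite inE.
  by move=> /mem_set ->; rewrite leq_addr.
by move=> /mem_set ->; rewrite leq_addl.
Qed.

Definition regular_mean K := forall F, zero_set (R := R) F ->
  forall e, 0 < e -> exists g, [/\ Cb g, forall x, \1_F x <= g x &
    K g < K \1_F + e].

Definition inner_regular K A := forall e : R, 0 < e ->
  exists F, [/\ zero_set (R := R) F, F `<=` A & K \1_(A `\` F) < e].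

Lemma inner_regular_zero K F : mean K -> zero_set (R := R) F ->
  inner_regular K F.
Proof.
move=> mK zF e e0; exists F; split=> //.
by rewrite setDv indic0 (mean_cst mK).
Qed.

Lemma inner_regularU K A B : mean K -> inner_regular K A ->
  inner_regular K B -> inner_regular K (A `|` B).
Proof.
move=> mK rA rB e e0; have e20 : 0 < e / 2 by rewrite divr_gt0.
have [F [zF FA AF]] := rA _ e20; have [G [zG GB BG]] := rB _ e20.
exists (F `|` G); split; [exact: zero_setU|exact: setUSS|].
apply: (le_lt_trans (@mean_indicU K (A `\` F) (B `\` G) _ mK _)); last lra.
move=> x [[Ax|Bx] nFG]; [left|right]; split=> // ?; apply: nFG; by [left|right].
Qed.

Lemma inner_regularI K A B : mean K -> inner_regular K A ->
  inner_regular K B -> inner_regular K (A `&` B).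
Proof.
move=> mK rA rB e e0; have e20 : 0 < e / 2 by rewrite divr_gt0.
have [F [zF FA AF]] := rA _ e20; have [G [zG GB BG]] := rB _ e20.
exists (F `&` G); split; [exact: zero_setI|exact: setISS|].
apply: (le_lt_trans (@mean_indicU K (A `\` F) (B `\` G) _ mK _)); last lra.
move=> x [[Ax Bx] nFG]; have [Fx|nFx] := pselect (F x); last by left.
by right; split=> // ?; apply: nFG.
Qed.

(** Take [g >= 1_F] with [K g < K 1_F + e / 2]. The zero set [Z = {g <= 1 - e / 2}] misses [F], and
    [g > 1 - e / 2] on the rest of the complement, so [1_{~F \ Z} + 1_F <= g + e / 2]; apply [K]. *)
Lemma inner_regular_cozero K F : mean K -> regular_mean K ->
  zero_set (R := R) F -> inner_regular K (~` F).
Proof.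
move=> mK rK zF e e0; have e20 : 0 < e / 2 by rewrite divr_gt0.
have [g [[cg bg] Fg gF]] := rK _ zF _ e20.
exists ([set x | g x <= 1 - e / 2]); split.
- by apply: zero_set_le => // x; exact: cvg_cst.
- move=> x /= gx Fx; have := Fg x; rewrite indicE mem_set//= => g1; lra.
have le1 : K (fun x => \1_(~` F `\` [set x | g x <= 1 - e / 2]) x + \1_F x)
    <= K (fun x => g x + e / 2).
  apply: (le_mean mK).
  - by apply: bddD; exact: bdd_indic.
  - by apply: bddD => //; exact: bdd_cst.
  move=> x; have := Fg x; rewrite !indicE.
  have [Fx|Fx] := pselect (F x).
    rewrite (mem_set Fx) memNset; last by move=> [].
    by rewrite /= add0r; lra.
  rewrite (memNset Fx) addr0 /= => g0.
  have [gx|gx] := leP (g x) (1 - e / 2).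
    by rewrite memNset /=; [lra|move=> [_]; exact].
  by rewrite mem_set/=; [lra|split=> //=; apply/negP; rewrite -ltNge].
move: le1; rewrite (meanD mK _ _ (bdd_indic _) (bdd_indic _)).
by rewrite (meanD mK _ _ bg (bdd_cst _)) (mean_cst mK); lra.
Qed.

(** The sets that are inner regular together with their complement form an algebra containing the
    zero sets, hence all of [U_alg]. *)
Lemma inner_regular_U_alg K A : mean K -> regular_mean K ->
  U_alg (R := R) A -> inner_regular K A.
Proof.
move=> mK rK UA.
suff [] : [set B | inner_regular K B /\ inner_regular K (~` B)] A by [].
apply: UA; split; last first.
  move=> F zF; split; first exact: inner_regular_zero.
  exact: inner_regular_cozero.
split=> [|B [rB rCB]|B C [rB rCB] [rC rCC]] /=.
- by split; apply: inner_regular_zero => //;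
    rewrite ?setC0; [exact: zero_set_set0|exact: zero_set_setT].
- by rewrite setCK.
- by rewrite setCU; split; [exact: inner_regularU|exact: inner_regularI].
Qed.

Lemma fa_prob_mean K : mean K -> regular_mean K ->
  fa_prob (fun A => K \1_A).
Proof.
move=> mK rK; split.
- by move=> A _; apply: (mean_ge0 mK) => [|x]; [exact: bdd_indic|rewrite indicE].
- move=> A B _ _ AB0; rewrite -(meanD mK); [|exact: bdd_indic..].
  congr K; apply/funext => x; rewrite !indicE in_setU.
  have [Ax|] := boolP (x \in A); last by rewrite add0r.
  have [Bx|] := boolP (x \in B); last by rewrite addr0.
  by have : set0 x by rewrite -AB0; split; exact: set_mem.
- by rewrite indicT; case: mK.
- by move=> A UA e e0; exact: inner_regular_U_alg.
Qed.

(** Monotonicity of [K] bounds the supremum by [K f]. Conversely, the superlevel sets of [f] are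
    zero sets, and stacking them in layers of height [e] gives a simple function between [f - e] and
    [f]. *)
Lemma fa_integral_mean K f : mean K -> Cb f ->
  fa_integral (fun A => K \1_A) f = K f.
Proof.
move=> mK [cf [M0 fM0]].
have bf : bdd_fun f by exists M0.
pose M := Num.max M0 0.
have M_ge0 : 0 <= M by rewrite le_max lexx orbT.
have fM x : - M <= f x <= M.
  by rewrite -ler_norml (le_trans (fM0 x))// le_max lexx.
have ubK : ubound [set r : R | exists (n : nat) (a : 'I_n -> R) (A : 'I_n -> set T),
        [/\ (forall i, U_alg (R := R) (A i)),
            (forall x, \sum_(i < n) a i * \1_(A i) x <= f x) &
            r = \sum_(i < n) a i * K \1_(A i)]] (K f).
  move=> _ [n [a [A [_ Af ->]]]]; rewrite -(mean_simple mK).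
  by apply: (le_mean mK) => //; exact: bdd_simple.
have approx e : 0 < e -> exists2 r, [set r : R | exists (n : nat) (a : 'I_n -> R) (A : 'I_n -> set T),
        [/\ (forall i, U_alg (R := R) (A i)),
            (forall x, \sum_(i < n) a i * \1_(A i) x <= f x) &
            r = \sum_(i < n) a i * K \1_(A i)]] r & K f <= r + e.
  (* With [n > 2 M / e] the layers reach above the whole range of [f], which excludes the truncated
     case [S = n] of [layer_sum]. *)
  move=> e0; pose n := Num.bound (2 * M / e).
  (* Index [0] carries the base level [- M] on the whole space; index [k + 1] adds [e] on the set
     where [f] reaches [(k + 1) e - M]. *)
  pose a (i : 'I_n.+1) := if (i : nat) is _.+1 then e else - M.
  pose A (i : 'I_n.+1) :=
    if (i : nat) is k.+1 then [set x | k.+1%:R * e - M <= f x] else setT.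
  have sumE x : \sum_(i < n.+1) a i * \1_(A i) x =
      - M + e * \sum_(i < n) ((i.+1)%:R <= (f x + M) / e)%R%:R.
    rewrite big_ord_recl {1}/a {1}/A indicT mulr1 mulr_sumr; congr (_ + _).
    apply: eq_bigr => i _; rewrite /a /A lift0 indicE; congr (_ * (nat_of_bool _)%:R).
    rewrite ler_pdivlMr// -lerBlDr.
    by apply/idP/idP; rewrite inE.
  have u0 x : 0 <= (f x + M) / e.
    by rewrite divr_ge0 ?(ltW e0)//; have := fM x; lra.
  exists (\sum_(i < n.+1) a i * K \1_(A i)).
    exists n.+1, a, A; split=> // [i|x].
      rewrite /A; case: (i : nat) => [|k]; apply: U_alg_zero.
        exact: zero_set_setT.
      by apply: zero_set_le => // x; exact: cvg_cst.
    have [_ + _] := layer_sum _ n (u0 x).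
    by rewrite sumE ler_pdivlMr// mulrC; lra.
  rewrite -(mean_simple mK) -[X in _ + X](mean_cst mK) -(meanD mK).
  - apply: (le_mean mK) => //.
      by apply: bddD; [exact: bdd_simple|exact: bdd_cst].
    move=> x; rewrite sumE; have [_ _] := layer_sum _ n (u0 x).
    set S := \sum_(i < n) _ => -[|SE].
      by rewrite ler_pdivrMr//; lra.
    have : 2 * M / e < n%:R.
      by apply: archi_boundP; rewrite divr_ge0 ?(ltW e0)// mulr_ge0.
    by rewrite SE ltr_pdivrMr//; have := fM x; lra.
  - exact: bdd_simple.
  - exact: bdd_cst.
apply/le_anti/andP; split.
  by apply: ge_sup => //; have [r Sr _] := approx _ ltr01; exists r.
apply/ler_addgt0Pr => e /approx[r Sr] /le_trans; apply.
by rewrite lerD2r; apply: ub_le_sup => //; exists (K f).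
Qed.

(** The measure is read off the extension [K]: the set function [A |-> L 1_A] itself may fail to be
    regular, while [K] agrees with [L] on [C_b]. *)
Theorem alexandroff_representation (L : (T -> R) -> R) : mean L ->
  exists gamma, fa_prob gamma /\ forall f, Cb f -> fa_integral gamma f = L f.
Proof.
move=> /regular_mean_extension[K [mK KL rK]]; exists (fun A => K \1_A); split.
  exact: fa_prob_mean.
by move=> f Cf; rewrite fa_integral_mean// KL.
Qed.

End Alexandroff.


(** * Integrating bounded continuous functions against Baire probabilities *)

Section BaireIntegral.
Context {R : realType} {X : ptopologicalType}.
Context (mu : probability (@BaireSpace R X) R).
Implicit Types phi psi : X -> R.

(** The rays [[x, +oo[] generate the Borel sets, and their preimages under [phi] are zero sets. *)
Lemma Baire_measurable_fun phi : continuous phi ->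
  measurable_fun setT (phi : @BaireSpace R X -> R).
Proof.
move=> cphi; apply: (measurability _ (measurable_realfun.RGenCInfty.measurableE R)) => //.
move=> _ [_ [x ->] <-]; rewrite setTI; apply: sub_sigma_algebra.
rewrite [X in zero_set X](_ : _ = [set y | x <= phi y]).
  by apply: zero_set_le => // y; exact: cvg_cst.
by apply/seteqP; split=> y /=; rewrite in_itv/= andbT.
Qed.

Lemma Baire_integrable phi : Cb phi -> mu.-integrable setT (EFin \o phi).
Proof.
move=> [cphi [M phiM]]; apply: measurable_bounded_integrable => //.
- exact: fin_num_fun_lty.
- exact: Baire_measurable_fun.
- exists M; split; [exact: num_real|move=> N MN x _; exact: le_trans (phiM x) (ltW MN)].
Qed.

(** On [C_b] the integral is finite, so [fine] loses nothing there. The same definition serves [nu],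
    as [intnu nu] unfolds to the same integral as [intmu nu]. *)
Definition Rint phi : R := fine (intmu mu phi).

Lemma intmuE phi : Cb phi -> intmu mu phi = (Rint phi)%:E.
Proof.
move=> /Baire_integrable iphi; rewrite /Rint fineK//.
exact: integrable_fin_num iphi.
Qed.

Lemma RintD phi psi : Cb phi -> Cb psi ->
  Rint (fun x => phi x + psi x) = Rint phi + Rint psi.
Proof. by move=> ? ?; apply: RintegralD => //; exact: Baire_integrable. Qed.

Lemma RintZ t phi : Cb phi -> Rint (fun x => t * phi x) = t * Rint phi.
Proof. by move=> ?; apply: RintegralZl => //; exact: Baire_integrable. Qed.

Lemma Rint_cst t : Rint (fun=> t) = t.
Proof.
apply: (etrans (Rintegral_cst mu measurableT t)); rewrite -[RHS]mulr1.
by congr (t * _); exact: (congr1 fine (probability_setT mu)).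
Qed.

Lemma le_Rint phi psi : Cb phi -> Cb psi -> (forall x, phi x <= psi x) ->
  Rint phi <= Rint psi.
Proof.
by move=> ? ? le; apply: le_Rintegral => //; exact: Baire_integrable.
Qed.

End BaireIntegral.

(** * Weak and strong duality *)

Section Duality.
Context {R : realType} {X Y : ptopologicalType}.
Context (mu : probability (@BaireSpace R X) R).
Context (nu : probability (@BaireSpace R Y) R).
Context (c : X * Y -> \bar R).

Lemma Cb_oplus (phi : X -> R) (psi : Y -> R) : Cb phi -> Cb psi ->
  Cb (fun z : X * Y => phi z.1 + psi z.2).
Proof.
move=> [cphi [M phiM]] [cpsi [N psiN]]; apply: CbD.
- split; last by exists M => z.
  by move=> z; apply: continuous_comp; [exact: cvg_fst|exact: cphi].
- split; last by exists N => z.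
  by move=> z; apply: continuous_comp; [exact: cvg_snd|exact: cpsi].
Qed.

Lemma weak_duality gamma phi psi : Gamma mu nu gamma ->
  DP_admissible c phi psi ->
  (intmu mu phi + intnu nu psi <= lsc_integral gamma c)%E.
Proof.
move=> [_ Gg] [Cphi Cpsi phic]; rewrite -Gg//; apply: ereal_sup_ubound.
exists (fun z => phi z.1 + psi z.2) => //; split; first exact: Cb_oplus.
by case.
Qed.

Lemma v_max_le_v_min : (v_max_DP mu nu c <= v_min_OP mu nu c)%E.
Proof.
apply: ge_ereal_sup => _ [[phi psi] /= adm <-].
by apply: le_ereal_inf_tmp => _ [gamma Gg <-]; exact: weak_duality.
Qed.

Lemma DP_admissible_le (phi : X -> R) (psi : Y -> R) (v : R) :
  v_max_DP mu nu c = v%:E -> DP_admissible c phi psi ->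
  Rint mu phi + Rint nu psi <= v.
Proof.
move=> vE adm; have [Cphi Cpsi _] := adm.
rewrite -lee_fin EFinD -vE -!intmuE//.
by apply: ereal_sup_ubound; exists (phi, psi).
Qed.

(** Integrate one variable at a time: for fixed [y], [- psi y <= phi] gives
    [- psi y <= Rint mu phi], which is then integrated in [y]. *)
Lemma Rint_oplus_ge0 (phi : X -> R) (psi : Y -> R) : Cb phi -> Cb psi ->
  (forall x y, 0 <= phi x + psi y) -> 0 <= Rint mu phi + Rint nu psi.
Proof.
move=> Cphi Cpsi ge0.
have phi_ge y : - psi y <= Rint mu phi.
  rewrite -(Rint_cst mu (- psi y)); apply: le_Rint => //; first exact: Cb_cst.
  by move=> x; have := ge0 x y; lra.
have : - Rint mu phi <= Rint nu psi; last lra.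
rewrite -(Rint_cst nu (- Rint mu phi)); apply: le_Rint => //; first exact: Cb_cst.
by move=> y; have := phi_ge y; lra.
Qed.

(** [cone_mean] applied to the constraints [L h <= I(phi, psi) + t v]. The given [f0] fills the slot
    of [f] in the constraints with [t = 0]. *)
Lemma dual_mean (v : R) : v_max_DP mu nu c = v%:E ->
  (exists f : X * Y -> R, Cb f /\ forall z, ((f z)%:E <= c z)%E) ->
  exists L : (X * Y -> R) -> R, [/\ mean L,
    forall phi psi, Cb phi -> Cb psi ->
      L (fun z => phi z.1 + psi z.2) = Rint mu phi + Rint nu psi &
    forall f, Cb f -> (forall z, ((f z)%:E <= c z)%E) -> L f <= v].
Proof.
move=> vE [f0 [Cf0 f0c]].
pose P := [set z : ((X * Y -> R) * R) | exists phi psi t f,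
  [/\ [/\ Cb phi, Cb psi & Cb f], 0 <= t, forall z, ((f z)%:E <= c z)%E,
      forall w, z.1 w <= phi w.1 + psi w.2 + t * f w &
      Rint mu phi + Rint nu psi + t * v <= z.2]].
have [|||| L [mL LP]] := @cone_mean _ R P.
- split.
  + move=> h r k s [phi [psi [t [f [[Cphi Cpsi Cf] t0 fc /= hf fr]]]]]
      [phi' [psi' [t' [f' [[Cphi' Cpsi' Cf'] t'0 fc' /= hf' fr']]]]].
    (* Two minorants of [c] merge into one: [t f + t' f' <= (t + t') max(f, f')], and the maximum is
       still below [c]. *)
    exists (fun x => phi x + phi' x), (fun y => psi y + psi' y), (t + t'),
      (fun z => Num.max (f z) (f' z)); split => /=.
    * by split; [exact: CbD|exact: CbD|exact: Cb_max].
    * exact: addr_ge0.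
    * by move=> z; case: (leP (f z) (f' z)).
    * move=> w; have := hf w; have := hf' w.
      have : t * f w <= t * Num.max (f w) (f' w).
        by rewrite ler_wpM2l// le_max lexx.
      have : t' * f' w <= t' * Num.max (f w) (f' w).
        by rewrite ler_wpM2l// le_max lexx orbT.
      by rewrite mulrDl; lra.
    * by rewrite !RintD// mulrDl; lra.
  + move=> u h r u0 [phi [psi [t [f [[Cphi Cpsi Cf] t0 fc /= hf fr]]]]].
    exists (fun x => u * phi x), (fun y => u * psi y), (u * t), f; split => //=.
    * by split => //; exact: CbZ.
    * exact: mulr_ge0.
    * by move=> w; rewrite -mulrA -!mulrDr ler_wpM2l.
    * by rewrite !RintZ// -mulrA -!mulrDr ler_wpM2l.
  + move=> r [phi [psi [t [f [[Cphi Cpsi Cf] t0 fc /= hf]]]]].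
    apply: le_trans; move: t0; rewrite le_eqVlt => /predU1P[t0|t0].
      rewrite -t0 mul0r addr0; apply: Rint_oplus_ge0 => // x y.
      by have := hf (x, y); rewrite -t0 mul0r addr0.
    (* For [t > 0], [0 <= phi (+) psi + t f] says that [(- phi / t, - psi / t)] lies below [f],
       hence below [c]. It is admissible, so its value is at most [v]. *)
    have : Rint mu (fun x => - t^-1 * phi x) + Rint nu (fun y => - t^-1 * psi y) <= v.
      apply: DP_admissible_le => //; split; [exact: CbZ|exact: CbZ|].
      move=> x y; apply: le_trans (fc (x, y)); rewrite lee_fin.
      rewrite -mulrDr mulNr lerNl -(ler_pM2l t0) mulrA divff ?gt_eqF// mul1r.
      by have := hf (x, y) => /=; lra.
    rewrite !RintZ// -mulrDr mulNr lerNl -(ler_pM2l t0) mulrA divff ?gt_eqF//.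
    by rewrite mul1r; lra.
- move=> h k r hk [phi [psi [t [f [C3 t0 fc /= hf fr]]]]].
  by exists phi, psi, t, f; split=> //= w; rewrite (le_trans (hk w)).
- exists (fun=> 1), (fun=> 0), 0, f0; split => //=.
  + by split=> //; exact: Cb_cst.
  + by move=> w; rewrite mul0r !addr0.
  + by rewrite !Rint_cst mul0r !addr0.
- exists (fun=> -1), (fun=> 0), 0, f0; split => //=.
  + by split=> //; exact: Cb_cst.
  + by move=> w; rewrite mul0r !addr0.
  + by rewrite !Rint_cst mul0r !addr0.
have Lle (phi : X -> R) (psi : Y -> R) : Cb phi -> Cb psi ->
    L (fun z => phi z.1 + psi z.2) <= Rint mu phi + Rint nu psi.
  move=> Cphi Cpsi; apply: LP; first by case: (Cb_oplus _ _ Cphi Cpsi).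
  exists phi, psi, 0, f0; split => //=.
    by move=> w; rewrite mul0r addr0.
  by rewrite mul0r addr0.
exists L; split => // [phi psi Cphi Cpsi|f Cf fc]; last first.
  apply: LP; first by case: Cf.
  exists (fun=> 0), (fun=> 0), 1, f; split => //=.
  - by split=> //; exact: Cb_cst.
  - by move=> w; rewrite mul1r !add0r.
  - by rewrite !Rint_cst mul1r !add0r.
apply/le_anti; rewrite Lle//=.
(* The upper bound at [(- phi, - psi)] is the missing lower bound at [(phi, psi)]. *)
have := Lle _ _ (CbZ (-1) _ Cphi) (CbZ (-1) _ Cpsi).
rewrite !RintZ//.
have -> : (fun z : X * Y => -1 * phi z.1 + -1 * psi z.2) =
    (fun z => -1 * (phi z.1 + psi z.2)) by apply/funext => z; rewrite mulrDr.
by rewrite (meanZ mL); [lra|case: (Cb_oplus _ _ Cphi Cpsi)].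
Qed.

(** The lower bound [m] acts twice: the admissible pair [(m, 0)] keeps [v_max_DP] above [-oo], and
    the constant [m] is the minorant asked for by [dual_mean]. Finiteness from above comes from weak
    duality. *)
Lemma strong_duality : (exists m : R, forall z, (m%:E <= c z)%E) ->
  (v_min_OP mu nu c < +oo)%E ->
  exists2 gamma, Gamma mu nu gamma & lsc_integral gamma c = v_max_DP mu nu c.
Proof.
move=> [m mc] vfin.
have vfin' : (v_max_DP mu nu c < +oo)%E := le_lt_trans v_max_le_v_min vfin.
have mv : (m%:E <= v_max_DP mu nu c)%E.
  apply: ereal_sup_ubound; exists ((fun=> m), (fun=> 0)).
    by split; [exact: Cb_cst|exact: Cb_cst|move=> x y /=; rewrite addr0].
  transitivity ((Rint mu (fun=> m))%:E + (Rint nu (fun=> 0))%:E)%E.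
    by congr (_ + _)%E; exact/intmuE/Cb_cst.
  by rewrite !Rint_cst -EFinD addr0.
have /fineK vE : v_max_DP mu nu c \is a fin_num.
  by rewrite fin_numElt vfin' (lt_le_trans _ mv)// ltNyr.
have [|L [mL Lphi Lc]] := dual_mean _ (esym vE).
  by exists (fun=> m); split; [exact: Cb_cst|].
have [gamma [fg gL]] := alexandroff_representation _ mL.
have Gg : Gamma mu nu gamma.
  split=> // phi psi Cphi Cpsi.
  rewrite gL; last exact: Cb_oplus.
  by rewrite Lphi// EFinD -!intmuE.
exists gamma => //; apply/le_anti/andP; split.
  apply: ge_ereal_sup => _ [f [Cf fc] <-].
  by rewrite gL// -vE lee_fin; exact: Lc.
by apply: ge_ereal_sup => _ [[phi psi] /= adm <-]; exact: weak_duality.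
Qed.

End Duality.

Theorem mainTheorem7 (R : realType) (X Y : ptopologicalType)
  (hX : hausdorff_space X) (crX : completely_regular_space X)
  (hY : hausdorff_space Y) (crY : completely_regular_space Y)
  (mu : probability (@BaireSpace R X) R) (nu : probability (@BaireSpace R Y) R)
  (c : X * Y -> \bar R) (hc : lsc_bi c)
  (hfin : (v_min_OP mu nu c < +oo)%E) :
  [/\ ((exists phi psi, DP_solution mu nu c phi psi) <->
       (exists phi psi gamma, [/\ Cb phi, Cb psi, Gamma mu nu gamma,
          (forall x y, ((phi x + psi y)%:E <= c (x, y))%E) &
          lsc_integral gamma c = (intmu mu phi + intnu nu psi)%E])),
      ((exists phi psi gamma, [/\ Cb phi, Cb psi, Gamma mu nu gamma,
          (forall x y, ((phi x + psi y)%:E <= c (x, y))%E) &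
          lsc_integral gamma c = (intmu mu phi + intnu nu psi)%E]) <->
       [/\ (exists phi psi, DP_solution mu nu c phi psi),
           (exists gamma, OP_solution mu nu c gamma) &
           v_max_DP mu nu c = v_min_OP mu nu c]) &
      (forall phi psi gamma, [/\ Cb phi, Cb psi, Gamma mu nu gamma,
          (forall x y, ((phi x + psi y)%:E <= c (x, y))%E) &
          lsc_integral gamma c = (intmu mu phi + intnu nu psi)%E] ->
        DP_solution mu nu c phi psi /\ OP_solution mu nu c gamma)].
Proof.
(* The measure from strong duality has cost [v_max_DP], which is the value of any dual solution. *)
have i_ii phi psi : DP_solution mu nu c phi psi -> exists gamma,
    [/\ Cb phi, Cb psi, Gamma mu nu gamma,
       (forall x y, ((phi x + psi y)%:E <= c (x, y))%E) &
       lsc_integral gamma c = (intmu mu phi + intnu nu psi)%E].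
  move=> [[Cphi Cpsi le_c] ->]; case: hc => _ c_lb _.
  by have [gamma Gg gE] := strong_duality mu nu c c_lb hfin; exists gamma.
(* The chain [I(phi, psi) <= v_max_DP <= v_min_OP <= int c dgamma] has equal ends, so it
   collapses. *)
have ii_sol phi psi gamma : [/\ Cb phi, Cb psi, Gamma mu nu gamma,
     (forall x y, ((phi x + psi y)%:E <= c (x, y))%E) &
     lsc_integral gamma c = (intmu mu phi + intnu nu psi)%E] ->
    [/\ DP_solution mu nu c phi psi, OP_solution mu nu c gamma &
        v_max_DP mu nu c = v_min_OP mu nu c].
  move=> [Cphi Cpsi Gg le_c gE].
  have le_max : (intmu mu phi + intnu nu psi <= v_max_DP mu nu c)%E.
    by apply: ereal_sup_ubound; exists (phi, psi).
  have min_le : (v_min_OP mu nu c <= lsc_integral gamma c)%E.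
    by apply: ereal_inf_lbound; exists gamma.
  have max_min := v_max_le_v_min mu nu c.
  have maxE : (intmu mu phi + intnu nu psi)%E = v_max_DP mu nu c.
    by apply/le_anti; rewrite le_max -gE (le_trans max_min).
  have vE : v_max_DP mu nu c = v_min_OP mu nu c.
    by apply/le_anti; rewrite max_min -maxE -gE.
  by split=> //; split=> //; rewrite gE maxE.
split.
- split=> [[phi [psi /i_ii[gamma H]]]|[phi [psi [gamma /ii_sol[]]]]].
    by exists phi, psi, gamma.
  by exists phi, psi.
- split=> [[phi [psi [gamma /ii_sol[Dsol Osol vE]]]]|[[phi [psi /i_ii[gamma H]]] _ _]].
    by split=> //; [exists phi, psi|exists gamma].
  by exists phi, psi, gamma.
- by move=> phi psi gamma /ii_sol[].
Qed.
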